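(* Let $X$ and $Y$ be real Hilbert spaces, let $A\in\mathcal L(X,Y)$, and let $P\subset X$ be a closed convex cone. Then for any $b\in Y$: (i) $b\in\overline{A(P)}$ if and only if for all $y\in Y$, $(A^*y)_+=0$ implies $\langle b,y\rangle_Y\le 0$. (ii) $b\in A(P)$ if and only if there exists $C>0$ such that for all $y\in Y$, $\langle b,y\rangle_Y\le C\,\|(A^*y)_+\|_X$.
   Context: $\mathcal L(X,Y)$ is the space of bounded linear operators from $X$ to $Y$; $A^*\in\mathcal L(Y,X)$ is the Hilbert adjoint of $A$. Cones are assumed to contain $0$. $A(P)=\{Ax : x\in P\}$. For $z\in X$, $z_+$ denotes the orthogonal projection of $z$ onto the closed convex cone $P$. *)

(* Defs.v *)
From HB Require Import structures.
From mathcomp Require Import all_boot all_order all_algebra.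
From mathcomp Require Import sesquilinear.
From mathcomp Require Import all_classical all_reals all_analysis.

Set Implicit Arguments.
Unset Strict Implicit.
Unset Printing Implicit Defensive.

Import Order.TTheory GRing.Theory Num.Theory.
Import numFieldNormedType.Exports.

Local Open Scope classical_set_scope.
Local Open Scope ring_scope.

HB.mixin Record isHilbert (R : realType) V & CompleteNormedModule R V := {
  inner : {dot V for idfun} ;
  inner_sqr_norm : forall x : V, inner x x = `|x| ^+ 2
}.

#[short(type="hilbertType")]
HB.structure Definition Hilbert (R : realType) :=
  {V of CompleteNormedModule R V & isHilbert R V}.

(* The vector representing the functional x |-> <A x, y>; it is unique, and for
   A linear and bounded it exists by the Riesz representation theorem. The
   default value 0 is used only when no representing vector exists. *)
Definition adjoint (R : realType) (X Y : hilbertType R) (A : X -> Y) (y : Y)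
    : X :=
  xget 0 [set z : X | forall x : X, inner (A x) y = inner x z].

(* The point of P nearest to z; it exists and is unique when P is nonempty,
   closed and convex. The default value 0 is used only when there is none. *)
Definition nearest_point (R : realType) (X : hilbertType R) (P : set X) (z : X)
    : X :=
  xget 0 [set p : X | P p /\ forall q : X, P q -> `|z - p| <= `|z - q|].

Definition is_cone (R : realType) (X : lmodType R) (P : set X) : Prop :=
  P 0 /\ forall (t : R) (x : X), 0 < t -> P x -> P (t *: x).

(* Main.v *)
Require Import Defs.
From HB Require Import structures.
From mathcomp Require Import all_boot all_order all_algebra.
From mathcomp Require Import sesquilinear.
From mathcomp Require Import all_classical all_reals all_analysis.
From mathcomp Require Import ring lra.

Set Implicit Arguments.
Unset Strict Implicit.
Unset Printing Implicit Defensive.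

Import Order.TTheory GRing.Theory Num.Theory.
Import numFieldNormedType.Exports.

Local Open Scope classical_set_scope.
Local Open Scope ring_scope.

(** Both parts separate [b] from a closed convex set in [Y] and read the
    result in [X] through the adjoint.  What links the two spaces is the support
    function of a closed convex cone [P]: writing [p] for the projection of [z]
    on [P], one has [<p, z> = |p|^2] and [<q, z> <= <q, p>] for every [q] in [P]
    ([cone_inner_nearest], [cone_inner_le]).  Hence [p = 0] means exactly that
    [z] is in the polar cone of [P], and the supremum of [<x, z>] over the [x] in
    [P] with [|x| <= C] is [C * |p|].

    For (i), the closure of [A(P)] is a closed convex cone, so either it
    contains [b] or some [y] is nonpositive on it and positive at [b]; such a [y]
    has [A^* y] in the polar cone of [P].

    For (ii), if [b = A x] then [<b, y> = <x, A^* y> <= |x| * |(A^* y)_+|].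
    Conversely, the bound says that [<b, y>] never exceeds the support function
    at [y] of [A(Q)], where [Q] is the part of [P] in the ball of radius [C].
    As [A(Q)] is convex, [b] belongs to it as soon as it is closed.  That
    closedness is usually deduced from weak compactness of [Q].  Here it comes
    from [residual_bound_attained], an elementary substitute: among the
    approximate solutions of [A x = b] in [Q], take those of almost least norm;
    the parallelogram law makes them converge strongly.  With [A] the identity,
    the same lemma gives the existence of projections, and from these follow
    the Riesz representation (so the adjoint is a genuine one) and separation. *)

(** * Inner products *)

Lemma innerC (R : realType) (X : hilbertType R) (x y : X) :
  inner x y = inner y x.
Proof. by rewrite hermC /= expr0 mul1r. Qed.

Lemma innerZl (R : realType) (X : hilbertType R) (a : R) (x y : X) :
  inner (a *: x) y = a * inner x y.
Proof. by rewrite linearZl_LR. Qed.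

Lemma innerZr (R : realType) (X : hilbertType R) (a : R) (x y : X) :
  inner x (a *: y) = a * inner x y.
Proof. by rewrite linearZr_LR. Qed.

Lemma innerBr (R : realType) (X : hilbertType R) (x y z : X) :
  inner x (y - z) = inner x y - inner x z.
Proof. by rewrite linearBr. Qed.

Lemma innerBl (R : realType) (X : hilbertType R) (x y z : X) :
  inner (x - y) z = inner x z - inner y z.
Proof. by rewrite linearBl. Qed.

Lemma sqr_normD (R : realType) (X : hilbertType R) (x y : X) :
  `|x + y| ^+ 2 = `|x| ^+ 2 + 2 * inner x y + `|y| ^+ 2.
Proof. by rewrite -!inner_sqr_norm linearDl !linearDr /= (innerC y x); ring. Qed.

Lemma sqr_normB (R : realType) (X : hilbertType R) (x y : X) :
  `|x - y| ^+ 2 = `|x| ^+ 2 - 2 * inner x y + `|y| ^+ 2.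
Proof. by rewrite sqr_normD linearNr normrN mulrN. Qed.

(** The Cauchy-Schwarz inequality: expand the square of the norm of
    [|y| x - |x| y]. *)
Lemma inner_le_norm (R : realType) (X : hilbertType R) (x y : X) :
  inner x y <= `|x| * `|y|.
Proof.
have [->|x0] := eqVneq x 0; first by rewrite linear0l normr0 mul0r.
have [->|y0] := eqVneq y 0; first by rewrite linear0r normr0 mulr0.
have xy0 : 0 < `|x| * `|y| by rewrite mulr_gt0 ?normr_gt0.
have := sqr_ge0 `| `|y| *: x - `|x| *: y |.
rewrite sqr_normB !normrZ !normr_id innerZl innerZr -(ler_pM2l xy0).
by lra.
Qed.

(** * Convex sets *)

(** Library convexity tests membership with [\in] and takes its weights in the
    type of reals of [[0, 1]]; real weights with explicit bounds can be handled
    by linear arithmetic. *)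
Lemma convex_setP (R : realType) (X : lmodType R) (D : set X) :
  @convex_set R X D <->
  forall (x y : X) (t : R), 0 <= t <= 1 -> D x -> D y ->
    D (t *: x + (1 - t) *: y).
Proof.
split=> [cD x y t /andP[t0 t1] Dx Dy|cD x y t].
  have i01t : Itv.spec (@Itv.num_sem R) (Itv.Real `[0%Z, 1%Z]) t.
    by rewrite /Itv.spec /= /Itv.num_sem /= num_real /= in_itv /= t0 t1.
  have := cD x y (Itv.mk i01t); rewrite !inE.
  exact.
by rewrite !inE; apply: cD; apply/andP; split.
Qed.

Lemma parallelogram (R : realType) (X : hilbertType R) (x y : X) :
  `|x - y| ^+ 2 + `|x + y| ^+ 2 = 2 * `|x| ^+ 2 + 2 * `|y| ^+ 2.
Proof. by rewrite sqr_normB sqr_normD; ring. Qed.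

(** If [d] is nearly a lower bound of the norm on a convex set, two points of the
    set of norm nearly [d] are close: their midpoint is no shorter than they are,
    up to a small error, so the parallelogram law leaves little for their
    difference.  The bound obtained for [|x - y| ^+ 2] is
    [4 (d + delta)^2 - 4 (d^2 - 2 d delta) = 16 d delta + 4 delta^2], which
    [delta <= 1] makes smaller than [delta * (16 d + 5)]. *)
Lemma almost_least_norm_close (R : realType) (X : hilbertType R) (x y : X)
    (d eps : R) :
  0 <= d -> 0 < eps ->
  let delta := Num.min 1 (eps ^+ 2 / (16 * d + 5)) in
  `|x| < d + delta -> `|y| < d + delta ->
  d - delta <= `|2^-1 *: x + (1 - 2^-1) *: y| -> `|x - y| < eps.
Proof.
move=> d0 e0 delta xd yd; have d16 : 0 < 16 * d + 5 by lra.
have delta0 : 0 < delta by rewrite lt_min ltr01 divr_gt0 ?exprn_gt0.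
have delta1 : delta <= 1 by rewrite ge_min lexx.
have deltae : delta * (16 * d + 5) <= eps ^+ 2.
  by rewrite -ler_pdivlMr // ge_min lexx orbT.
have -> : 1 - 2^-1 = 2^-1 :> R by field.
rewrite -scalerDr normrZ ger0_norm ?invr_ge0// => xyd.
rewrite -ltr_sqr ?nnegrE ?normr_ge0 ?(ltW e0)//.
have := parallelogram x y.
have := normr_ge0 x; have := normr_ge0 y; have := normr_ge0 (x + y).
move: xd yd xyd; move: `|x| `|y| `|x + y| `|x - y| => a b' s r.
move=> ad bd sd s0 b0 a0 pl.
have aa : a ^+ 2 <= (d + delta) ^+ 2 by nra.
have bb : b' ^+ 2 <= (d + delta) ^+ 2 by nra.
(* when [d < delta], the left-hand side is nonpositive *)
have ss : 4 * (d ^+ 2 - 2 * d * delta) <= s ^+ 2.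
  by have [|] := leP delta d; nra.
by nra.
Qed.

(** The sets [D e] of points of [Q] with residual at most [c + e] are closed,
    convex and nonincreasing as [e] tends to 0, so the infimum of the norm on
    [D e] increases to a finite limit, the real [sup S] below.  Picking in each
    [D e] a point of norm less than [sup S + e] gives, by
    [almost_least_norm_close], a Cauchy family; its limit lies in every [D e].
    Boundedness is required of [D 1] only, which lets the lemma apply to unbounded
    [Q] when projecting a point. *)
Lemma residual_bound_attained (R : realType) (X : hilbertType R)
    (Y : normedModType R) (A : {linear X -> Y}) (Q : set X) (b : Y) (c M : R) :
  continuous A -> closed Q -> @convex_set R X Q ->
  (forall e : R, 0 < e -> exists2 x, Q x & `|A x - b| <= c + e) ->
  (forall x, Q x -> `|A x - b| <= c + 1 -> `|x| <= M) ->
  exists2 x, Q x & `|A x - b| <= c.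
Proof.
move=> Ac Qcl /convex_setP Qcv approx bnd.
pose D (e : R) := [set x | Q x /\ `|A x - b| <= c + e].
have Dmid e x y : D e x -> D e y -> D e (2^-1 *: x + (1 - 2^-1) *: y).
  move=> [Qx Ax] [Qy Ay]; split; first by apply: Qcv => //; lra.
  have -> : 1 - 2^-1 = 2^-1 :> R by field.
  have -> : A (2^-1 *: x + 2^-1 *: y) - b =
      2^-1 *: (A x - b) + 2^-1 *: (A y - b).
    rewrite linearD !linearZ /= !scalerBr addrACA -opprD -scalerDl.
    by rewrite (_ : 2^-1 + 2^-1 = 1 :> R) ?scale1r//; field.
  rewrite (le_trans (ler_normD _ _))// !normrZ ger0_norm ?invr_ge0//.
  by lra.
have Dmono e e' : e <= e' -> D e `<=` D e'.
  by move=> ee' x [Qx Ax]; split => //; rewrite (le_trans Ax)// lerD2l.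
have Dcl e : closed (D e).
  have -> : D e = Q `&` (fun x => `|A x - b|) @^-1` [set r | r <= c + e] by [].
  apply: closedI => //; apply: preimage_closed; last exact: closed_le.
  move=> x _; apply: (@cvg_norm _ _ _ (nbhs x) _ (fun x => A x - b)).
  by apply: cvgB; [exact: Ac|exact: cvg_cst].
pose S := [set r | exists2 e : R, 0 < e & forall x, D e x -> r <= `|x|].
have S0 : S 0 by exists 1.
have supS : has_sup S.
  split; first by exists 0.
  exists M => r [e e0 De].
  have m0 : 0 < Num.min e 1 by rewrite lt_min e0 ltr01.
  have [x Qx Ax] := approx _ m0.
  have Dx : D (Num.min e 1) x by [].
  rewrite (le_trans (De x _))//.
    by apply: Dmono Dx; rewrite ge_min lexx.
  by apply: bnd => //; apply: (le_trans Ax); rewrite lerD2l ge_min lexx orbT.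
have d0 : 0 <= sup S by apply: sup_upper_bound S0.
have low (delta : R) : 0 < delta ->
    exists2 e : R, 0 < e & forall x, D e x -> sup S - delta <= `|x|.
  move=> delta0; have [r [e e0 De] rS] := sup_adherent delta0 supS.
  by exists e => // x /De; apply: le_trans; exact: ltW.
have near_min (e : R) : exists x, 0 < e -> D e x /\ `|x| < sup S + e.
  apply: contrapT => /forallNP no.
  have e0 : 0 < e by apply: contrapT => e0; apply: (no 0).
  have : S (sup S + e).
    exists e => // x Dx; rewrite leNgt; apply/negP => xS.
    exact: (no x).
  by move/(sup_upper_bound supS); rewrite gerDl leNgt e0.
have [u uP] := choice near_min.
have ucvg : cvg (u @ 0^'+).
  apply/cauchy_cvgP/cauchy_exP => eps eps0.
  set delta := Num.min 1 (eps ^+ 2 / (16 * sup S + 5)).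
  have delta0 : 0 < delta.
    by rewrite lt_min ltr01 divr_gt0 ?exprn_gt0//; lra.
  have [e e0 De] := low _ delta0.
  pose e1 := Num.min e delta.
  have e10 : 0 < e1 by rewrite lt_min e0.
  have uD t : 0 < t -> t <= e1 -> D e (u t) /\ `|u t| < sup S + delta.
    move=> t0; rewrite /e1 le_min => /andP[te td]; have [Du us] := uP _ t0.
    split; first exact: Dmono Du.
    by rewrite (lt_le_trans us)// lerD2l.
  exists (u e1); have [D1 s1] := uD e1 e10 (lexx _).
  suff : \forall t \near 0^'+, ball (u e1) eps (u t) by [].
  near=> t.
  have [D2 s2] : D e (u t) /\ `|u t| < sup S + delta.
    by apply: uD; near: t; [exact: nbhs_right_gt|exact: nbhs_right_le].
  rewrite -ball_normE /=.
  by apply: (almost_least_norm_close d0 eps0 s1 s2); exact/De/Dmid.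
have Dlim e : 0 < e -> D e (lim (u @ 0^'+)).
  move=> e0; apply: (closed_cvg _ (Dcl e) _ _ ucvg); near=> t.
  have [t0 te] : 0 < t /\ t <= e.
    by split; near: t; [exact: nbhs_right_gt|exact: nbhs_right_le].
  exact: (Dmono _ _ te _ (uP _ t0).1).
exists (lim (u @ 0^'+)); first by have [] := Dlim 1 ltr01.
by apply/ler_addgt0Pr => e e0; have [] := Dlim e e0.
Unshelve. all: by end_near. Qed.

(** * Projection on a closed convex set *)

(** The distance from [z] to [P] is a residual bound for the identity map that can
    be approached, hence one that is attained. *)
Lemma nearest_pointP (R : realType) (X : hilbertType R) (P : set X) (z : X) :
  closed P -> @convex_set R X P -> P !=set0 ->
  P (nearest_point P z) /\
  forall q, P q -> `|z - nearest_point P z| <= `|z - q|.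
Proof.
move=> Pcl Pcv [p0 Pp0].
pose S := [set `|p - z| | p in P].
have infS : has_inf S.
  by split; [exists `|p0 - z|, p0|exists 0 => _ [p _ <-]].
have [p Pp pz] : exists2 p, P p & `|(idfun : {linear X -> X}) p - z| <= inf S.
  apply: (@residual_bound_attained _ _ _ _ _ _ _ (inf S + 1 + `|z|)) => //.
  - by move=> x; exact: cvg_id.
  - move=> e e0; have [_ [p Pp <-] pS] := inf_adherent e0 infS.
    by exists p => //; exact: ltW.
  - move=> p Pp pS; rewrite -[p](subrK z) (le_trans (ler_normD _ _))//.
    by rewrite lerD2r.
have nearP : exists p, P p /\ forall q, P q -> `|z - p| <= `|z - q|.
  exists p; split => // q Pq; rewrite distrC (le_trans pz)// distrC.
  by apply: (inf_lbound infS.2); exists q.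
exact: (@xgetPex _ 0 [set p | P p /\ forall q, P q -> `|z - p| <= `|z - q|]).
Qed.

(** The segment from the projection [p] towards [q] stays in [P], so
    [t |-> |z - p - t (q - p)|^2] is minimal at 0 on [[0, 1]]; a positive inner
    product would make it decrease there. *)
Lemma nearest_point_obtuse (R : realType) (X : hilbertType R) (P : set X)
    (z q : X) :
  closed P -> @convex_set R X P -> P q ->
  inner (z - nearest_point P z) (q - nearest_point P z) <= 0.
Proof.
move=> Pcl Pcv Pq.
have [] := @nearest_pointP _ _ P z Pcl Pcv (ex_intro _ q Pq).
set p := nearest_point P z => Pp pmin.
move/convex_setP: Pcv => Pcv.
rewrite leNgt; apply/negP => ipos.
set i := inner _ _ in ipos.
set n := `|q - p| ^+ 2.
have key t : 0 < t <= 1 -> 2 * i <= t * n.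
  move=> /andP[t0 t1]; have t01 : 0 <= t <= 1 by rewrite (ltW t0).
  have := pmin _ (Pcv q p t t01 Pq Pp).
  have -> : z - (t *: q + (1 - t) *: p) = (z - p) - t *: (q - p).
    rewrite scalerBr scalerBl scale1r -!addrA; congr (z + _).
    by rewrite !opprD !opprK addrCA.
  rewrite -(@ler_sqr _ `|z - p|) ?nnegrE ?normr_ge0//.
  rewrite (sqr_normB (z - p)) innerZr normrZ exprMn (gtr0_norm t0) -/i -/n => h.
  by rewrite -(ler_pM2l t0); nra.
have n0 : 0 <= n by exact: sqr_ge0.
(* a step [t] with [t * n < i]; the [+ 1] covers [n = 0] *)
have := key (Num.min 1 (i / (n + 1))).
have ni : 0 < i / (n + 1) by rewrite divr_gt0//; lra.
rewrite lt_min ltr01 ni ge_min lexx => /(_ isT).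
apply/negP; rewrite -ltNge.
have : Num.min 1 (i / (n + 1)) * n <= i / (n + 1) * n.
  by rewrite ler_wpM2r// ge_min lexx orbT.
move/le_lt_trans; apply.
have : i / (n + 1) * (n + 1) = i by rewrite divfK//; lra.
by nra.
Qed.

(** The functional is the inner product with [b - p], where [p] is the projection
    of [b] on [K]: on [K] it is at most its value at [p], which falls short of its
    value at [b] by [|b - p|^2]. *)
Lemma strict_separation (R : realType) (Y : hilbertType R) (K : set Y) (b : Y) :
  closed K -> @convex_set R Y K -> K !=set0 -> ~ K b ->
  exists y c, (forall k, K k -> inner k y <= c) /\ c < inner b y.
Proof.
move=> Kcl Kcv K0 Kb; have [Kp _] := nearest_pointP b Kcl Kcv K0.
have obt k := @nearest_point_obtuse _ _ _ b k Kcl Kcv.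
set p := nearest_point K b in Kp obt.
exists (b - p), (inner p (b - p)); split.
  by move=> k /obt; rewrite innerC innerBl subr_le0.
rewrite -subr_gt0 -innerBl /= inner_sqr_norm exprn_gt0// normr_gt0 subr_eq0.
by apply/eqP => bp; apply: Kb; rewrite bp.
Qed.

(** * Closed convex images *)

(** A point of the closure of the image is a value that [A] approaches on [Q] with
    arbitrarily small residuals; as [Q] is bounded, residual 0 is attained. *)
Lemma closed_linear_image (R : realType) (X : hilbertType R)
    (Y : normedModType R) (A : {linear X -> Y}) (Q : set X) (M : R) :
  continuous A -> closed Q -> @convex_set R X Q ->
  (forall x, Q x -> `|x| <= M) -> closed (A @` Q).
Proof.
move=> Ac Qcl Qcv Qb b clb.
have [x Qx] : exists2 x, Q x & `|A x - b| <= 0.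
  apply: (@residual_bound_attained _ _ _ A Q b 0 M) => //; last first.
    by move=> x Qx _; exact: Qb.
  move=> e e0; have [_ [[x Qx <-]]] := clb _ (nbhsx_ballx b e e0).
  by rewrite -ball_normE /= => h; exists x => //; rewrite add0r distrC ltW.
by rewrite normr_le0 subr_eq0 => /eqP <-; exists x.
Qed.

Lemma convex_linear_image (R : realType) (X Y : lmodType R)
    (A : {linear X -> Y}) (Q : set X) :
  @convex_set R X Q -> @convex_set R Y (A @` Q).
Proof.
move=> /convex_setP Qcv; apply/convex_setP => _ _ t t01 [x Qx <-] [y Qy <-].
by exists (t *: x + (1 - t) *: y); [exact: Qcv|rewrite linearD !linearZ].
Qed.

Lemma convex_closure (R : realType) (Y : normedModType R) (K : set Y) :
  @convex_set R Y K -> @convex_set R Y (closure K).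
Proof.
move=> /convex_setP Kcv; apply/convex_setP => x y t t01 clx cly U.
rewrite -nbhs_ballE => -[e /= e0 eU].
have [x' [Kx']] := clx _ (nbhsx_ballx x e e0).
have [y' [Ky']] := cly _ (nbhsx_ballx y e e0).
rewrite -!ball_normE /= => yy xx.
exists (t *: x' + (1 - t) *: y'); split; first exact: Kcv.
apply: eU; rewrite -ball_normE /=.
have -> : t *: x + (1 - t) *: y - (t *: x' + (1 - t) *: y') =
    t *: (x - x') + (1 - t) *: (y - y') by rewrite !scalerBr addrACA opprD.
rewrite (le_lt_trans (ler_normD _ _))// !normrZ.
case/andP: t01 => t0 t1; rewrite (ger0_norm t0) ger0_norm ?subr_ge0//.
have me : Num.max `|x - x'| `|y - y'| < e by rewrite gt_max xx yy.
have xm : `|x - x'| <= Num.max `|x - x'| `|y - y'| by rewrite le_max lexx.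
have ym : `|y - y'| <= Num.max `|x - x'| `|y - y'| by rewrite le_max lexx orbT.
by apply: le_lt_trans me; nra.
Qed.

(** * Riesz representation and the adjoint *)

Lemma continuous_inner (R : realType) (X : hilbertType R) (y : X) :
  continuous (fun x : X => inner x y).
Proof.
apply: (linear_bounded_continuous (applyr (@inner R X) y : {linear X -> R^o})).1.
apply/bounded_funP => r; exists (r * `|y|) => x xr.
rewrite /= ler_norml.
have h w : `|w| <= r -> inner w y <= r * `|y|.
  by move=> wr; rewrite (le_trans (inner_le_norm _ _))// ler_wpM2r.
by rewrite h// lerNl -linearNl h ?normrN.
Qed.

Lemma continuous_bounded_linear (R : realType) (X Y : normedModType R)
    (A : {linear X -> Y}) : bounded_fun_norm A -> continuous A.
Proof. by move=> bA; apply/linear_bounded_continuous/bounded_funP. Qed.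

(** The projection [p] of 0 on the hyperplane [f = 1] is orthogonal to the kernel
    of [f], so [f] is the inner product with [p] up to a scalar. *)
Lemma riesz (R : realType) (X : hilbertType R) (f : {linear X -> R^o}) :
  continuous f -> exists z, forall x, f x = inner x z.
Proof.
move=> fc.
have fD x y : f (x + y) = f x + f y :> R by exact: linearD.
have fZ a x : f (a *: x) = a * f x :> R by exact: linearZ.
have [f0|/existsNP[x0 /eqP fx0]] := pselect (forall x, f x = 0).
  by exists 0 => x; rewrite linear0r f0.
pose H := [set x | f x = 1].
have Hcl : closed H.
  have -> : H = f @^-1` [set 1] by [].
  by apply: preimage_closed; [move=> x _; exact: fc|exact: closed_eq].
have Hcv : @convex_set R X H.
  apply/convex_setP => x y t _ /= fx fy.
  by rewrite /H /= fD !fZ fx fy !mulr1 addrC subrK.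
have H0 : H ((f x0)^-1 *: x0) by rewrite /H /= fZ mulVf.
have [] := nearest_pointP 0 Hcl Hcv (ex_intro _ _ H0).
set p := nearest_point H 0 => Hp _.
have ortho h : f h = 0 -> inner p h = 0.
  have half g : f g = 0 -> 0 <= inner p g.
    move=> fg; have Hpg : H (p + g) by rewrite /H /= fD Hp fg addr0.
    have := nearest_point_obtuse 0 Hcl Hcv Hpg.
    by rewrite -/p sub0r addrC addKr linearNl oppr_le0.
  move=> fh; apply/eqP; rewrite eq_le half// andbT -oppr_ge0 -linearNr half//.
  by rewrite linearN /= fh oppr0.
have p0 : inner p p != 0.
  rewrite inner_sqr_norm sqrf_eq0 normr_eq0; apply/eqP => p0.
  by move: Hp; rewrite /H /= p0 linear0 => /esym/eqP; rewrite oner_eq0.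
exists ((inner p p)^-1 *: p) => x.
have fxp : f (x - (f x : R) *: p) = 0 by rewrite linearB fZ Hp mulr1 subrr.
have px : inner p x = f x * inner p p.
  by rewrite -innerZr; apply/eqP; rewrite -subr_eq0 -innerBr ortho.
by rewrite innerZr innerC px mulrC mulfK.
Qed.

Lemma adjointE (R : realType) (X Y : hilbertType R) (A : {linear X -> Y})
    (y : Y) (x : X) :
  continuous A -> inner (A x) y = inner x (adjoint A y).
Proof.
move=> Ac; pose f : {linear X -> R^o} := applyr (@inner R Y) y \o A.
have fc : continuous f.
  by move=> w; apply: continuous_comp; [exact: Ac|exact: continuous_inner].
have ex := riesz fc.
exact: (@xgetPex _ 0 [set z : X | forall x, inner (A x) y = inner x z] ex x).
Qed.

(** * Projection on a closed convex cone *)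

Lemma cone_nearest_in (R : realType) (X : hilbertType R) (P : set X)
    (z : X) :
  closed P -> @convex_set R X P -> is_cone P -> P (nearest_point P z).
Proof.
move=> Pcl Pcv Pcone.
by apply: (nearest_pointP z Pcl Pcv _).1; exists 0; exact: Pcone.1.
Qed.

(** Both [0] and [2 p] are in the cone, so [z - p] is orthogonal to [p], the
    projection of [z]. *)
Lemma cone_inner_nearest (R : realType) (X : hilbertType R) (P : set X)
    (z : X) :
  closed P -> @convex_set R X P -> is_cone P ->
  inner (nearest_point P z) z = `|nearest_point P z| ^+ 2.
Proof.
move=> Pcl Pcv Pcone; have Pp := cone_nearest_in z Pcl Pcv Pcone.
have P2p : P (2 *: nearest_point P z) by apply: Pcone.2.
have := nearest_point_obtuse z Pcl Pcv Pcone.1.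
have := nearest_point_obtuse z Pcl Pcv P2p.
move: (nearest_point P z) => p.
rewrite scaler_nat mulr2n addrK sub0r linearNr /= innerBl inner_sqr_norm.
rewrite (innerC p z).
by lra.
Qed.

(** The angle [<z - p, q - p> <= 0] loses its term in [p] since [z - p] is
    orthogonal to [p]. *)
Lemma cone_inner_le (R : realType) (X : hilbertType R) (P : set X)
    (z q : X) :
  closed P -> @convex_set R X P -> is_cone P -> P q ->
  inner q z <= inner q (nearest_point P z).
Proof.
move=> Pcl Pcv Pcone Pq; have := nearest_point_obtuse z Pcl Pcv Pq.
have := cone_inner_nearest z Pcl Pcv Pcone; move: (nearest_point P z) => p.
rewrite innerBr !innerBl inner_sqr_norm (innerC q z) (innerC q p) (innerC p z).
by lra.
Qed.

(** When [z] is in the polar cone, its projection [p], being in [P], satisfies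
    [|p|^2 = <p, z> <= 0]. *)
Lemma nearest_cone_eq0 (R : realType) (X : hilbertType R) (P : set X)
    (z : X) :
  closed P -> @convex_set R X P -> is_cone P ->
  nearest_point P z = 0 <-> forall q, P q -> inner q z <= 0.
Proof.
move=> Pcl Pcv Pcone; split=> [p0 q Pq|polar].
  by have := cone_inner_le z Pcl Pcv Pcone Pq; rewrite p0 linear0r.
have := polar _ (cone_nearest_in z Pcl Pcv Pcone).
rewrite cone_inner_nearest// => n0.
by apply/eqP; rewrite -normr_eq0 -sqrf_eq0 eq_le n0 sqr_ge0.
Qed.

(** The point is the projection of [z] rescaled to norm [C].  By [cone_inner_le]
    and Cauchy-Schwarz no point of [P] in this ball does better, so this is the
    support function of that part of [P]. *)
Lemma cone_ball_support (R : realType) (X : hilbertType R) (P : set X)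
    (C : R) (z : X) :
  closed P -> @convex_set R X P -> is_cone P -> 0 < C ->
  exists x, [/\ P x, `|x| <= C & inner x z = C * `|nearest_point P z|].
Proof.
move=> Pcl Pcv Pcone C0; have Pp := cone_nearest_in z Pcl Pcv Pcone.
have pz := cone_inner_nearest z Pcl Pcv Pcone.
move: (nearest_point P z) Pp pz => p Pp pz.
have [->|p0] := eqVneq p 0.
  by exists 0; rewrite normr0 mulr0 linear0l ltW//; split => //; exact: Pcone.1.
have np0 : 0 < `|p| by rewrite normr_gt0.
exists ((C / `|p|) *: p); split.
- by apply: Pcone.2 => //; rewrite divr_gt0.
- by rewrite normrZ gtr0_norm ?divr_gt0// divfK ?gt_eqF.
- by rewrite innerZl pz expr2 mulrA divfK ?gt_eqF.
Qed.

Lemma convex_setI_ball (R : realType) (X : normedModType R) (P : set X)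
    (C : R) :
  @convex_set R X P -> @convex_set R X (P `&` [set x | `|x| <= C]).
Proof.
move=> /convex_setP Pcv; apply/convex_setP => x y t t01 [Px xC] [Py yC].
split; first exact: Pcv.
rewrite /= (le_trans (ler_normD _ _))// !normrZ.
have /andP[t0 t1] := t01; rewrite (ger0_norm t0) ger0_norm ?subr_ge0//.
by move: xC yC => /=; nra.
Qed.

Lemma closed_norm_le (R : realType) (X : normedModType R) (C : R) :
  closed [set x : X | `|x| <= C].
Proof.
apply: (@preimage_closed _ _ (fun x : X => `|x|) [set r | r <= C]).
  by move=> x _; exact: norm_continuous.
exact: closed_le.
Qed.

(** * The two characterizations *)

Theorem theorem1p2 (R : realType) (X Y : hilbertType R)
    (A : {linear X -> Y}) (A_bounded : bounded_fun_norm A)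
    (P : set X) (P_closed : closed P)
    (P_convex : convex_set (P : set (convex_lmodType X))) (P_cone : is_cone P)
    (b : Y) :
  (closure (A @` P) b <->
   (forall y : Y, nearest_point P (adjoint A y) = 0 -> inner b y <= 0)) /\
  ((A @` P) b <->
   (exists C : R, 0 < C /\
      forall y : Y, inner b y <= C * `|nearest_point P (adjoint A y)|)).
Proof.
have Ac := continuous_bounded_linear A_bounded.
have P0 := P_cone.1.
split; split.
- move=> clb y /(nearest_cone_eq0 _ P_closed P_convex P_cone) polar.
  have cl : closed [set k : Y | inner k y <= 0].
    apply: (@preimage_closed _ _ (fun k : Y => inner k y) [set r | r <= 0]).
      by move=> k _; exact: continuous_inner.
    exact: closed_le.
  apply: cl; apply: closureS clb => _ [x Px <-] /=.
  by rewrite adjointE//; exact: polar.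
- move=> h; apply: contrapT => nb.
  have [|||y [c [Kc cb]]] := strict_separation _ _ _ nb.
  + exact: closed_closure.
  + exact/convex_closure/convex_linear_image.
  + by exists (A 0); apply: subset_closure; exists 0.
  have c0 : 0 <= c.
    have := Kc (A 0); rewrite [in inner _ _]linear0 linear0l; apply.
    by apply: subset_closure; exists 0.
  have : inner b y <= 0.
    apply: h; apply/nearest_cone_eq0 => // q Pq; rewrite -adjointE//.
    rewrite leNgt; apply/negP => pos.
    (* a multiple of [q] at which the functional exceeds its bound on the cone *)
    have := Kc (A (((c + 1) / inner (A q) y) *: q)).
    rewrite linearZ innerZl divfK ?gt_eqF// => Kbig.
    suff : c + 1 <= c by lra.
    apply: Kbig; apply: subset_closure.
    exists (((c + 1) / inner (A q) y) *: q); last by rewrite linearZ.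
    by apply: P_cone.2 => //; rewrite divr_gt0//; lra.
  by rewrite leNgt (le_lt_trans c0).
(* [+ 1] keeps the constant positive when [x = 0] *)
- move=> [x Px <-]; exists (`|x| + 1); split => [|y].
    by rewrite ltr_wpDl.
  rewrite adjointE// (le_trans (cone_inner_le _ _ _ _ Px))//.
  rewrite (le_trans (inner_le_norm _ _))// ler_wpM2r//.
  by rewrite lerDl.
- move=> [C [C0 h]]; apply: contrapT => nb.
  pose Q := P `&` [set x | `|x| <= C].
  have Qcl : closed Q by apply: closedI => //; exact: closed_norm_le.
  have Qcv : @convex_set R X Q by exact: convex_setI_ball.
  have [|||nQ|y [c [Kc cb]]] := @strict_separation _ _ (A @` Q) b.
  + by apply: (@closed_linear_image _ _ _ _ _ C) => // x [].
  + exact: convex_linear_image.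
  + by exists (A 0), 0 => //; split => //=; rewrite normr0 ltW.
  + by apply: nb; case: nQ => x [Px _] <-; exists x.
  have [x [Px xC xy]] :=
    cone_ball_support (adjoint A y) P_closed P_convex P_cone C0.
  have : inner (A x) y <= c by apply: Kc; exists x.
  rewrite adjointE// xy => /(le_trans (h y)).
  by rewrite leNgt cb.
Qed.
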